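(* (1) Let $U:X\to\mathcal P(X)$ be a weak LLSP-cone assignment with a witnessing partition $\langle X_\alpha:\alpha<\delta\rangle$. Then: (i) $\mathbb B_U$ is a neighborhood system of an LLSP space $X_U=\langle X,\tau_U\rangle$; (ii) $U(p)$ is a clopen Lindelöf subspace of $X_U$ for each $p\in X$; (iii) $I_{\le\alpha}(X_U)\supseteq X_{\le\alpha}$ for each $\alpha<\delta$. Moreover, if $U$ is an LLSP-cone assignment (with this witnessing partition), then (iv) $I_\alpha(X_U)=X_\alpha$ for each $\alpha<\delta$. (2) Let $X=\langle X,\tau\rangle$ be an LLSP space, let $\delta$ be the least ordinal with $I_\delta(X)=\emptyset$, and let $U:X\to\tau$ be a neighborhood assignment (i.e. $p\in U(p)\in\tau$ for all $p\in X$) such that for each $\alpha<\delta$ and each $p\in I_\alpha(X)$ the set $U(p)$ is a clopen Lindelöf subset of $X$ with $U(p)\setminus I_{<\alpha}(X)=\{p\}$. Then $U$ is an LLSP-cone assignment with the witnessing partition $\langle I_\alpha(X):\alpha<\delta\rangle$, and $\tau_U=\tau$.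
   Context: An LLSP space is a locally Lindelöf (every point has a Lindelöf neighborhood), scattered, Hausdorff P-space; a P-space is a space in which the intersection of every countable family of open sets is open. For a topological space $X$ and an ordinal $\alpha$, the Cantor–Bendixson level $I_\alpha(X)$ is the set of isolated points of the subspace $X\setminus\bigcup\{I_\beta(X):\beta<\alpha\}$; $X$ is scattered if $X=\bigcup\{I_\beta(X):\beta<\alpha\}$ for some ordinal $\alpha$. Write $I_{<\alpha}(X)=\bigcup_{\beta<\alpha}I_\beta(X)$ and $I_{\le\alpha}(X)=\bigcup_{\beta\le\alpha}I_\beta(X)$; for a partition $\langle X_\alpha:\alpha<\delta\rangle$ write $X_{<\beta}=\bigcup_{\alpha<\beta}X_\alpha$, $X_{\le\beta}=\bigcup_{\alpha\le\beta}X_\alpha$. For a set $S$, $[S]^2$ is the set of two-element subsets of $S$ and $[S]^{\le\omega}$ is the set of (at most) countable subsets of $S$. For $U:X\to\mathcal P(X)$ and $I\subseteq X$, $U[I]=\bigcup\{U(x):x\in I\}$. A function $U:X\to\mathcal P(X)$ is a weak LLSP-cone assignment (for $X$) if for some ordinal $\delta$ the set $X$ has a partition $\langle X_\alpha:\alpha<\delta\rangle$ (a witnessing partition) and there is a function $D:[X]^2\to[X]^{\le\omega}$ (the LLSP-function associated with $U$) such that: (a) for all $\beta<\delta$ and $p\in X_\beta$: $p\in U(p)$ and $U(p)\setminus\{p\}\subseteq X_{<\beta}$; (b) for each $\{x,y\}\in[X]^2$, if $x\notin U(y)$ and $y\notin U(x)$, then $D(x,y)\subseteq U(x)\cap U(y)$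 and $U(x)\cap U(y)\subseteq U[D(x,y)]$; (c) for each $\{x,y\}\in[X]^2$, if $x\in U(y)$, then $D(x,y)\subseteq U(x)\setminus U(y)$ and $U(x)\setminus U(y)\subseteq U[D(x,y)]$. $U$ is an LLSP-cone assignment (with witnessing partition $\langle X_\alpha:\alpha<\delta\rangle$) if moreover (d) for all $\alpha<\beta<\delta$, all $p\in X_\beta$ and all $I\in[U(p)\setminus\{p\}]^{\le\omega}$: $(U(p)\setminus U[I])\cap X_\alpha\neq\emptyset$. For $U:X\to\mathcal P(X)$ and $p\in X$ let $\mathcal B_U(p)=\{U(p)\setminus U[I]: I\in[U(p)\setminus\{p\}]^{\le\omega}\}$ and $\mathbb B_U=\{\mathcal B_U(p):p\in X\}$. That $\mathbb B_U$ is a neighborhood system of a topology $\tau_U$ means that there is a (unique) topology $\tau_U$ on $X$ in which, for each $p\in X$, $\mathcal B_U(p)$ is a base of open neighborhoods at $p$; $X_U$ denotes $\langle X,\tau_U\rangle$. *)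

(* Defs.v *)
From HB Require Import structures.
From mathcomp Require Import all_boot all_order.
From mathcomp Require Import all_classical.
From mathcomp Require Import topology.

Set Implicit Arguments.
Unset Strict Implicit.
Unset Printing Implicit Defensive.

Import Order.TTheory.
Local Open Scope classical_set_scope.

(* An ordinal is represented by a well-ordered type L: the elements a : L stand
   for the ordinals a < L, so that a family indexed by the ordinals below L is
   a function on L. *)
Record well_ordered_type := WellOrderedType {
  wo_disp : Order.disp_t ;
  wo_sort :> orderType wo_disp ;
  wo_wf : well_founded (fun a b : wo_sort => (a < b)%O) }.

Definition below (L : well_ordered_type) (X : Type) (F : L -> set X) (a : L) :
  set X := \bigcup_(b in [set b | (b < a)%O]) F b.

Definition upto (L : well_ordered_type) (X : Type) (F : L -> set X) (a : L) :
  set X := \bigcup_(b in [set b | (b <= a)%O]) F b.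

(* The topologies on a fixed set X, given by their open sets.  The type
   [space tau] is X equipped with the topology tau. *)
Record topology_on (X : Type) := TopologyOn {
  opens : set (set X) ;
  opensT : opens setT ;
  opensI : setI_closed opens ;
  opens_bigcup : forall C : set (set X),
    C `<=` opens -> opens (\bigcup_(V in C) V) }.

Definition space (X : Type) (tau : topology_on X) : Type := X.

Section Space.
Variables (X : Type) (tau : topology_on X).

Let opens_bigU (I : Type) (f : I -> set X) :
  (forall i, opens tau (f i)) -> opens tau (\bigcup_i f i).
Proof.
move=> fo; have -> : \bigcup_i f i = \bigcup_(V in range f) V.
  by rewrite bigcup_image.
by apply: opens_bigcup => _ [i _ <-].
Qed.

HB.instance Definition _ := gen_eqMixin (space tau).
HB.instance Definition _ := gen_choiceMixin (space tau).
HB.instance Definition _ :=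
  isOpenTopological.Build (space tau) (opensT tau) (@opensI X tau) opens_bigU.

End Space.

Section TopologicalNotions.
Variable T : topologicalType.

Definition lindelof (A : set T) := forall C : set (set T),
  C `<=` open -> A `<=` \bigcup_(V in C) V ->
  exists C' : set (set T),
    [/\ C' `<=` C, countable C' & A `<=` \bigcup_(V in C') V].

Definition locally_lindelof := forall x : T, exists2 N, nbhs x N & lindelof N.

Definition P_space := forall C : set (set T),
  countable C -> C `<=` open -> open (\bigcap_(V in C) V).

(* [CB_level a] is the Cantor-Bendixson level I_a(T); see [CB_levelE]. *)
Definition CB_level (L : well_ordered_type) : L -> set T :=
  Fix (@wo_wf L) (fun=> set T) (fun a I_ =>
    isolated (~` [set x | exists b (ba : (b < a)%O), I_ b ba x])).

Lemma CB_levelE (L : well_ordered_type) (a : L) :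
  CB_level a = isolated (~` below (@CB_level L) a).
Proof.
rewrite /CB_level Fix_eq -/(@CB_level L).
  congr (isolated (~` _)); apply/seteqP; split=> x.
    by move=> [b [ba bx]]; exists b.
  by move=> [b ba bx]; exists b, ba.
move=> b f g fg; congr (isolated (~` _)); apply/seteqP.
by split=> x [c [cb cx]]; exists c, cb; [rewrite -fg|rewrite fg].
Qed.

Definition scattered :=
  exists L : well_ordered_type, \bigcup_a @CB_level L a = setT.

(* L is the least ordinal with I_L(T) empty. *)
Definition CB_height (L : well_ordered_type) :=
  isolated (~` \bigcup_a @CB_level L a) = set0 /\
  forall a : L, CB_level a <> set0.

Definition LLSP_space :=
  [/\ locally_lindelof, scattered, hausdorff_space T & P_space].

Definition neighborhood_system (B : T -> set (set T)) := forall p : T,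
  B p `<=` open_nbhs p /\
  forall N, nbhs p N -> exists2 V, B p V & V `<=` N.

End TopologicalNotions.

Section ConeAssignments.
Variable X : Type.

Definition pairs : set (set X) :=
  [set S | exists x y, x <> y /\ S = [set x; y]].

Definition countable_subsets (S : set X) : set (set X) :=
  [set I | I `<=` S /\ countable I].

Variable U : X -> set X.

Definition cones (I : set X) : set X := \bigcup_(x in I) U x.

Definition weak_LLSP_cone_assignment (delta : well_ordered_type)
    (P : delta -> set X) :=
  partition setT P setT /\
  exists D : set X -> set X,
  [/\ set_fun pairs (countable_subsets setT) D,
      (forall (b : delta) (p : X), P b p ->
         U p p /\ U p `\ p `<=` below P b),
      (forall x y : X, x <> y -> ~ U y x -> ~ U x y ->
         D [set x; y] `<=` U x `&` U y /\
         U x `&` U y `<=` cones (D [set x; y]))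
    & (forall x y : X, x <> y -> U y x ->
         D [set x; y] `<=` U x `\` U y /\
         U x `\` U y `<=` cones (D [set x; y]))].

Definition LLSP_cone_assignment (delta : well_ordered_type)
    (P : delta -> set X) :=
  weak_LLSP_cone_assignment P /\
  forall (a b : delta) (p : X) (I : set X), (a < b)%O -> P b p ->
    countable_subsets (U p `\ p) I ->
    (U p `\` cones I) `&` P a !=set0.

Definition cone_base (p : X) : set (set X) :=
  [set U p `\` cones I | I in countable_subsets (U p `\ p)].

(* tau is the topology tau_U: the one and only topology on X having cone_base
   as a neighborhood system *)
Definition cone_topology (tau : topology_on X) :=
  unique (fun t : topology_on X =>
    @neighborhood_system (space t) cone_base) tau.

End ConeAssignments.

(* Main.v *)
Require Import Defs.
From mathcomp Require Import all_boot all_order.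
From mathcomp Require Import all_classical.
From mathcomp Require Import topology.

Set Implicit Arguments.
Unset Strict Implicit.
Unset Printing Implicit Defensive.

Import Order.TTheory.
Local Open Scope classical_set_scope.

(** The engine of both halves is that a cone [U p] exceeds [p] only by points of
    smaller rank.  Hence [U] is antisymmetric ([ranked_asym]), no cone with apex
    in [U p `\ p] contains [p], and the sets [U p `\` cones U I] with [I]
    countable really are sets around [p].

    From a weak assignment to a space.  Declare [V] open when each [p] in [V] has
    a member of [cone_base U p] inside [V].  Merging countably many countable
    sets [I] shows that countable intersections of open sets are open, which
    covers at once the axioms for finite intersections and the P-space property.
    Clauses (b) and (c) make every cone clopen ([weak_clopen]): [D]
    supplies the apexes of the countably many cones to be removed from [U p] in
    order to stay inside [U q] or, if neither apex is in the other cone, to avoid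
    it.  In a P-space a countable union of clopen
    cones is closed, so the members of [cone_base] are open.  Cones are Lindelof
    by induction on the rank: one open set catches the apex together with
    everything outside countably many lower cones.  The rank bounds the
    Cantor-Bendixson rank, since [U p] isolates [p] from everything of no smaller
    rank, and clause (d) says that this bound cannot be improved
    ([LLSP_cone_CB_level]).

    From a space to an assignment.  Conversely, when cones are clopen and
    Lindelof, [U x `&` U y] and [U x `\` U y] are closed in a Lindelof set, hence
    covered by the cones over countably many of their own points; this supplies
    [D] ([lindelof_weak]).  The same covering argument applied to [U p `\` V]
    shows that [cone_base U] generates the given topology ([lindelof_cone_base]).
    Clause (d) is the general fact that an open set meeting a Cantor-Bendixson
    level meets all the lower ones ([CB_level_meets]). *)

(** * Countable sets, pairs and well-orders *)

Lemma countable_setU (X : Type) (A B : set X) :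
  countable A -> countable B -> countable (A `|` B).
Proof.
move=> Ac Bc; rewrite -bigcup2E; apply: bigcup_countable => //.
by move=> [|[|i]] _ //=; exact: countable0.
Qed.

(** Choosing one preimage per point of [C] would need a default point of [X];
    choosing a set of at most one preimage does not. *)
Lemma countable_sub_image (X Y : Type) (f : X -> Y) (A : set X) (C : set Y) :
  countable C -> C `<=` f @` A ->
  exists2 I, countable_subsets A I & C `<=` f @` I.
Proof.
move=> Cc CA.
have /choice[g gP] : forall y, exists J, countable_subsets A J /\
    (C y -> (f @` J) y).
  move=> y; have [/CA[x Ax fx]|nCy] := pselect (C y).
    exists [set x]; split; last by exists x.
    by split; [move=> _ ->|exact: countable1].
  by exists set0; split=> //; split; [exact: sub0set|exact: countable0].
exists (\bigcup_(y in C) g y).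
  split; first by move=> x [y _ gx]; exact: (gP y).1.1 x gx.
  by apply: bigcup_countable => // y _; exact: (gP y).1.2.
by move=> y Cy; have [x gx fx] := (gP y).2 Cy; exists x => //; exists y.
Qed.

Lemma set2_inj (X : Type) (x y x' y' : X) : [set x; y] = [set x'; y'] ->
  (x' = x /\ y' = y) \/ (x' = y /\ y' = x).
Proof.
move=> /seteqP[s1 s2].
have [xx|xx] := s2 x' (or_introl erefl); have [yy|yy] := s2 y' (or_intror erefl);
  simpl in xx, yy; subst x' y'; auto.
- by left; split=> //; have [] := s1 y (or_intror erefl).
- by left; split=> //; have [] := s1 x (or_introl erefl).
Qed.

Lemma well_ordered_ind (L : well_ordered_type) (Q : L -> Prop) :
  (forall a, (forall b, (b < a)%O -> Q b) -> Q a) -> forall a, Q a.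
Proof. exact: (well_founded_ind (@wo_wf L)). Qed.

Lemma well_ordered_min (L : well_ordered_type) (Q : set L) a : Q a ->
  exists2 b, Q b & forall c, Q c -> (b <= c)%O.
Proof.
elim/well_ordered_ind: a => a IH Qa.
have [[b [ba Qb]]|no] := pselect (exists b, (b < a)%O /\ Q b); first exact: IH Qb.
by exists a => // c Qc; rewrite leNgt; apply/negP => ca; apply: no; exists c.
Qed.

(** * Lindelof sets and P-spaces *)

Section LindelofSets.
Variable T : topologicalType.
Implicit Types A B : set T.

(** The complement of [B] completes a cover of [B] to a cover of [A]. *)
Lemma lindelof_closed_sub A B : lindelof A -> closed B -> B `<=` A -> lindelof B.
Proof.
move=> lA cB BA C Co BC.
have [||C' [C'C C'c AC']] := lA (C `|` [set ~` B]).
- by move=> V [/Co//|->]; exact: closed_openC.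
- move=> x Ax; have [/BC[V CV Vx]|nBx] := pselect (B x).
    by exists V => //; left.
  by exists (~` B) => //; right.
exists (C' `&` C); split; [by move=> V []| |].
  exact: sub_countable (subset_card_le (@subIsetl _ _ _)) C'c.
move=> x Bx; have [V C'V Vx] := AC' x (BA x Bx).
by exists V => //; split=> //; have [//|VB] := C'C V C'V; move: Vx; rewrite VB.
Qed.

Lemma lindelof_bigcup (I : Type) (D : set I) (F : I -> set T) :
  countable D -> (forall i, D i -> lindelof (F i)) ->
  lindelof (\bigcup_(i in D) F i).
Proof.
move=> Dc lF C Co FC.
have /choice[g gP] : forall i, exists C', D i ->
    [/\ C' `<=` C, countable C' & F i `<=` \bigcup_(V in C') V].
  move=> i; have [Di|nDi] := pselect (D i); last by exists set0.
  have [|C' C'P] := lF i Di C Co; last by exists C'.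
  by move=> x Fx; apply: FC; exists i.
exists (\bigcup_(i in D) g i); split.
- by move=> V [i /gP[gC _ _]]; exact: gC.
- by apply: bigcup_countable => // i /gP[].
- move=> x [i Di Fx]; have [_ _ /(_ x Fx)[V gV Vx]] := gP i Di.
  by exists V => //; exists i.
Qed.

(** The source of every countable set of apexes built from a topology: the apexes
    can be taken inside the covered set itself. *)
Lemma lindelof_cones (U : T -> set T) A :
  lindelof A -> (forall x, A x -> open (U x) /\ U x x) ->
  exists2 I, countable_subsets A I & A `<=` cones U I.
Proof.
move=> lA UP.
have [||C [CU Cc AC]] := lA (U @` A).
- by move=> _ [x /UP[Uo _] <-].
- by move=> x Ax; exists (U x); [exists x|exact: (UP x Ax).2].
have [I IA CI] := countable_sub_image Cc CU.
exists I => // x /AC[V /CI[z Iz <-] Uzx]; by exists z.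
Qed.

Lemma P_space_closed_bigcup (I : Type) (D : set I) (F : I -> set T) :
  P_space T -> countable D -> (forall i, D i -> closed (F i)) ->
  closed (\bigcup_(i in D) F i).
Proof.
move=> PT Dc cF; rewrite -[X in closed X]setCK; apply: open_closedC.
rewrite setC_bigcup -(bigcap_image _ (fun i => ~` F i) id).
apply: PT; first exact: sub_countable (card_image_le _ _) Dc.
by move=> _ [i Di <-]; apply: closed_openC; exact: cF.
Qed.

End LindelofSets.

(** * Topologies determined by a neighborhood system *)

Lemma topology_on_eq (X : Type) (s t : topology_on X) :
  opens s = opens t -> s = t.
Proof.
case: s t => [o oT oI oU] [o' oT' oI' oU'] /= ss'.
move: oT' oI' oU'; rewrite -ss' => oT' oI' oU'.
by congr TopologyOn; exact: Prop_irrelevance.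
Qed.

Lemma neighborhood_system_open (X : Type) (t : topology_on X)
    (B : X -> set (set X)) : @neighborhood_system (space t) B ->
  opens t = [set V | forall p, V p -> exists2 W, B p W & W `<=` V].
Proof.
move=> Bt; apply/seteqP; split=> V.
  by move=> Vo p Vp; apply: (Bt p).2; exact: (@open_nbhs_nbhs (space t)).
move=> VB; change (@open (space t) V); rewrite openE => p Vp.
have [W BW WV] := VB p Vp.
by rewrite /interior/= nbhsE; exists W => //; exact: (Bt p).1.
Qed.

(** Uniqueness in [cone_topology] comes for free, because a neighborhood system
    determines the open sets. *)
Lemma cone_topologyP (X : Type) (U : X -> set X) (t : topology_on X) :
  @neighborhood_system (space t) (cone_base U) -> cone_topology U t.
Proof.
move=> Ut; split=> // s Us; apply: topology_on_eq.
by rewrite (neighborhood_system_open Us) (neighborhood_system_open Ut).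
Qed.

(** * Assignments that respect a rank *)

(** Clause (a) of the definition of a weak assignment, isolated because both
    directions of the theorem rest on it: [P a] is the set of points of rank
    [a]. *)
Definition ranked_assignment (X : Type) (U : X -> set X)
    (L : well_ordered_type) (P : L -> set X) :=
  partition setT P setT /\
  forall b p, P b p -> U p p /\ U p `\ p `<=` below P b.

Section RankedAssignments.
Variables (X : Type) (U : X -> set X) (L : well_ordered_type) (P : L -> set X).
Hypothesis UP : ranked_assignment U P.

Lemma ranked_ex p : exists a, P a p.
Proof.
have [[covP _ _] _] := UP.
by have [a _ Pa] : cover setT P p; [rewrite covP|exists a].
Qed.

Lemma ranked_uniq p a b : P a p -> P b p -> a = b.
Proof. by have [[_ tP _] _] := UP => Pa Pb; apply: (tP a b) => //; exists p. Qed.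

Lemma ranked_self p : U p p.
Proof. by have [a Pa] := ranked_ex p; exact: (UP.2 a p Pa).1. Qed.

Lemma ranked_lt p q b : P b p -> U p q -> q <> p ->
  exists2 a, (a < b)%O & P a q.
Proof. by move=> Pb Uq qp; have [] := (UP.2 b p Pb).2 q => // a ab; exists a. Qed.

Lemma ranked_asym x y : x <> y -> U y x -> ~ U x y.
Proof.
move=> xy Uyx Uxy; have [b Pb] := ranked_ex y.
have [a ab Pa] := ranked_lt Pb Uyx xy.
have [b' ba Pb'] := ranked_lt Pa Uxy (nesym xy).
by move: (lt_trans ba ab); rewrite (ranked_uniq Pb' Pb) ltxx.
Qed.

Lemma ranked_notin_cones p (I : set X) : I `<=` U p `\ p -> ~ cones U I p.
Proof. by move=> Ip [i /Ip[Upi ip]]; exact: ranked_asym. Qed.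

End RankedAssignments.

(** * Clopen cones in a P-space *)

Section ClopenCones.
Variables (T : topologicalType) (U : T -> set T).
Variables (L : well_ordered_type) (P : L -> set T).
Hypotheses (PT : P_space T) (UP : ranked_assignment U P).
Hypothesis Uclopen : forall p, clopen (U p).

Lemma closed_cones (I : set T) : countable I -> closed (cones U I).
Proof.
by move=> Ic; apply: P_space_closed_bigcup => // i _; exact: (Uclopen i).2.
Qed.

Lemma cone_base_open_nbhs p : cone_base U p `<=` open_nbhs p.
Proof.
move=> _ [I [Ip Ic] <-]; split.
  by apply: openI; [exact: (Uclopen p).1|exact/closed_openC/closed_cones].
by split; [exact: (ranked_self UP)|exact: (ranked_notin_cones UP)].
Qed.

(** Induction on the rank of [p].  The member [V] of the cover containing [p]
    contains [U p `\` cones U I] for some countable [I], and what remains,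
    [U p `&` cones U I], is a closed part of a countable union of cones of
    smaller rank. *)
Lemma lindelof_cone :
  @neighborhood_system T (cone_base U) -> forall p, lindelof (U p).
Proof.
move=> Usys p; have [b Pb] := ranked_ex UP p.
elim/well_ordered_ind: b p Pb => b IH p Pb C Co UC.
have [V CV Vp] := UC p (ranked_self UP p).
have [|_ [I [Ip Ic] <-] IV] := (Usys p).2 V.
  by apply: open_nbhs_nbhs; split=> //; exact: Co.
have lI : lindelof (cones U I).
  apply: lindelof_bigcup => // i /Ip[Upi ip].
  by have [a ab Pa] := ranked_lt UP Pb Upi ip; exact: IH Pa.
have lpI : lindelof (U p `&` cones U I).
  apply: lindelof_closed_sub lI _ _; last by move=> x [].
  by apply: closedI; [exact: (Uclopen p).2|exact: closed_cones].
have [|C' [C'C C'c pIC']] := lpI C Co; first by move=> x [/UC].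
exists (V |` C'); split.
- by move=> W [->//|/C'C].
- exact: countable_setU (countable1 V) C'c.
- move=> x Upx; have [Ix|nIx] := pselect (cones U I x).
    by have [//|W C'W Wx] := pIC' x; exists W => //; right.
  by exists V; [left|exact: IV].
Qed.

(** If [V] is an open set around [p], the closed set [U p `\` V] is Lindelof and so
    is covered by countably many cones with apexes outside [V]; these apexes
    differ from [p] because [p] lies in [V]. *)
Lemma lindelof_cone_base : (forall p, lindelof (U p)) ->
  @neighborhood_system T (cone_base U).
Proof.
move=> lU p; split; first exact: cone_base_open_nbhs.
rewrite nbhsE => N [V [Vo Vp] VN].
have lV : lindelof (U p `\` V).
  apply: lindelof_closed_sub (lU p) _ _; last by move=> x [].
  by apply: closedI; [exact: (Uclopen p).2|exact: open_closedC].
have [x _|I [IV Ic] VI] := lindelof_cones lV (U := U).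
  by split; [exact: (Uclopen x).1|exact: (ranked_self UP)].
exists (U p `\` cones U I).
  exists I => //; split=> // i /IV[Upi nVi]; split=> // ip.
  by apply: nVi; rewrite ip.
by move=> x [Upx nIx]; apply: VN; apply: contrapT => nVx; apply: nIx; exact: VI.
Qed.

(** The sets to be covered in clauses (b) and (c) are closed subsets of cones, so
    countably many apexes in them suffice.  The function [D] sees only the
    unordered pair; by [ranked_asym] at most one of the three cases
    [U y x], [U x y] or neither can occur for it, so one countable set serves
    both orderings. *)
Lemma lindelof_weak :
  (forall p, lindelof (U p)) -> weak_LLSP_cone_assignment U P.
Proof.
move=> Ulindelof; split; first exact: UP.1.
have cov x (A : set T) : A `<=` U x -> closed A ->
    exists2 I, countable_subsets A I & A `<=` cones U I.
  move=> AU Ac; apply: lindelof_cones.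
    exact: lindelof_closed_sub (Ulindelof x) Ac AU.
  by move=> z _; split; [exact: (Uclopen z).1|exact: (ranked_self UP)].
have covD x y : exists2 I, countable_subsets (U x `\` U y) I &
    U x `\` U y `<=` cones U I.
  apply: (cov x); first by move=> z [].
  by apply: closedI; [exact: (Uclopen x).2|exact/open_closedC/(Uclopen y).1].
have covI x y : exists2 I, countable_subsets (U x `&` U y) I &
    U x `&` U y `<=` cones U I.
  apply: (cov x); first by move=> z [].
  by apply: closedI; [exact: (Uclopen x).2|exact: (Uclopen y).2].
pose good x y I :=
  (~ U y x -> ~ U x y -> I `<=` U x `&` U y /\ U x `&` U y `<=` cones U I) /\
  (U y x -> I `<=` U x `\` U y /\ U x `\` U y `<=` cones U I).
have goodP x y : x <> y -> exists2 I, countable I & good x y I /\ good y x I.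
  move=> xy; have [Uyx|nUyx] := pselect (U y x).
    have nUxy := ranked_asym UP xy Uyx.
    have [I [IU Ic] UI] := covD x y.
    by exists I => //; split; split.
  have [Uxy|nUxy] := pselect (U x y).
    have [I [IU Ic] UI] := covD y x.
    by exists I => //; split; split.
  have [I [IU Ic] UI] := covI x y.
  by exists I => //; split; split=> //; rewrite setIC.
have /choice[D DP] : forall S, exists I, countable I /\
    forall x y, x <> y -> S = [set x; y] -> good x y I.
  move=> S; have [[x [y [xy ->]]]|nS] := pselect (pairs S); last first.
    exists set0; split; first exact: countable0.
    by move=> x y xy Sxy; exfalso; apply: nS; exists x, y.
  have [I Ic [gxy gyx]] := goodP x y xy; exists I; split=> // x' y' _.
  by move=> E; have [[-> ->]|[-> ->]] := set2_inj E.
exists D; split.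
- by move=> S _; split=> //; exact: (DP S).1.
- exact: UP.2.
- by move=> x y xy; exact: ((DP [set x; y]).2 x y xy erefl).1.
- by move=> x y xy; exact: ((DP [set x; y]).2 x y xy erefl).2.
Qed.

(** Of two distinct points, at least one is outside the cone of the other, and
    that cone and its complement separate them. *)
Lemma ranked_hausdorff : hausdorff_space T.
Proof.
have sep x y : ~ U x y ->
    exists2 AB : set T * set T, (x \in AB.1 /\ y \in AB.2) &
      [/\ open AB.1, open AB.2 & AB.1 `&` AB.2 == set0].
  move=> nUxy; exists (U x, ~` U x) => /=.
    by split; apply/mem_set => //; exact: (ranked_self UP).
  have [Uo Uc] := Uclopen x; split=> //; first exact: closed_openC.
  by rewrite setICr.
rewrite open_hausdorff => x y /eqP xy.
have [Uxy|] := pselect (U x y); last exact: sep.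
have [[A B] /= [yA xB] [oA oB AB]] := sep y x (ranked_asym UP (nesym xy) Uxy).
by exists (B, A) => //=; split=> //; rewrite setIC.
Qed.

End ClopenCones.

(** * The topology generated by a weak assignment *)

Section ConeTopology.
Variables (X : Type) (U : X -> set X).

Definition cone_opens : set (set X) :=
  [set V | forall p, V p -> exists2 W, cone_base U p W & W `<=` V].

(** The union of the countable sets removed for each [V] in [C] is still
    countable.  The instances [C = set0] and [C = [set A] `|` [set B]] are the
    topology axioms [cone_opensT] and [cone_opensI]. *)
Lemma cone_opens_bigcap (C : set (set X)) : countable C ->
  C `<=` cone_opens -> cone_opens (\bigcap_(V in C) V).
Proof.
move=> Cc Co p Cp.
have /choice[g gP] : forall V, exists I, C V ->
    countable_subsets (U p `\ p) I /\ U p `\` cones U I `<=` V.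
  move=> V; have [CV|nCV] := pselect (C V); last by exists set0.
  by have [_ [I Ip <-] IV] := Co V CV p (Cp V CV); exists I.
exists (U p `\` cones U (\bigcup_(V in C) g V)).
  exists (\bigcup_(V in C) g V) => //; split.
    by move=> x [V /gP[[gU _] _]]; exact: gU.
  by apply: bigcup_countable => // V /gP[[]].
move=> x [Upx nx] V CV; have [_ gV] := gP V CV; apply: gV; split=> //.
by move=> [i gi Ui]; apply: nx; exists i => //; exists V.
Qed.

Lemma cone_opensT : cone_opens setT.
Proof. by rewrite -(bigcap_set0 id); apply: cone_opens_bigcap. Qed.

Lemma cone_opensI : setI_closed cone_opens.
Proof.
move=> A B Ao Bo; rewrite -(bigcap_set1 id A) -(bigcap_set1 id B) -bigcap_setU.
by apply: cone_opens_bigcap; [exact: countable_setU|move=> V [->|->]].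
Qed.

Lemma cone_opens_bigcup (C : set (set X)) :
  C `<=` cone_opens -> cone_opens (\bigcup_(V in C) V).
Proof.
move=> Co p [V CV Vp]; have [W BW WV] := Co V CV p Vp.
by exists W => // x /WV Vx; exists V.
Qed.

Definition cone_topology_on : topology_on X :=
  TopologyOn cone_opensT cone_opensI cone_opens_bigcup.

Notation T := (space cone_topology_on).

Lemma cone_topology_P_space : P_space T.
Proof. exact: cone_opens_bigcap. Qed.

Section WeakAssignment.
Variables (L : well_ordered_type) (P : L -> set X).
Hypothesis weakU : weak_LLSP_cone_assignment U P.

Lemma weak_ranked : ranked_assignment U P.
Proof. by have [partP [D [_ UP _ _]]] := weakU. Qed.

(** Clause (c) for [p] in [U q] says that removing the cones over [D [set p; q]]
    from [U p] leaves a subset of [U q], so [U q] is open.  To avoid [U q] from a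
    point [p] outside it, remove the cone of [q] when [q] is in [U p], and
    otherwise the cones that clause (b) provides for [U p `&` U q].  In each
    case the removed apexes differ from [p] because [p] is on the other side of
    [U q]. *)
Lemma weak_clopen (q : T) : @clopen T (U q).
Proof.
have UP := weak_ranked; have [partP [D [Dc _ DI DD]]] := weakU.
have Dpair x y : x <> y -> countable (D [set x; y]).
  by move=> xy; have [|] := Dc [set x; y]; first by exists x, y.
split.
  move=> p Uqp; have [->|pq] := pselect (p = q).
    exists (U q `\` cones U set0); last by move=> x [].
    by exists set0 => //; split=> //; exact: countable0.
  have [D1 D2] := DD p q pq Uqp.
  exists (U p `\` cones U (D [set p; q])).
    exists (D [set p; q]) => //; split; last exact: Dpair.
    by move=> x /D1[Upx nUqx]; split=> // xp; move: nUqx; rewrite xp.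
  by move=> x [Upx nDx]; apply: contrapT => nUqx; apply: nDx; exact: D2.
rewrite -[X in closed X]setCK; apply: open_closedC.
change (cone_opens (~` U q)) => p nUqp.
have pq : p <> q by move=> pq; apply: nUqp; rewrite pq; exact: (ranked_self UP).
have [Upq|nUpq] := pselect (U p q).
  exists (U p `\` cones U [set q]).
    exists [set q] => //; split; last exact: countable1.
    by move=> _ ->; split=> // qp; exact: pq.
  by move=> x [_ nqx] Uqx; apply: nqx; exists q.
have [D1 D2] := DI p q pq nUqp nUpq.
exists (U p `\` cones U (D [set p; q])).
  exists (D [set p; q]) => //; split; last exact: Dpair.
  by move=> x /D1[Upx Uqx]; split=> // xp; apply: nUqp; rewrite -xp.
by move=> x [Upx nDx] Uqx; apply: nDx; exact: D2.
Qed.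

Lemma weak_neighborhood_system : @neighborhood_system T (cone_base U).
Proof.
move=> p; split.
  exact: (cone_base_open_nbhs cone_topology_P_space weak_ranked weak_clopen).
rewrite nbhsE => N [V [Vo Vp] VN]; have [W BW WV] := Vo p Vp.
by exists W => // x /WV/VN.
Qed.

Lemma weak_lindelof (p : T) : @lindelof T (U p).
Proof.
exact: (lindelof_cone cone_topology_P_space weak_ranked weak_clopen
  weak_neighborhood_system).
Qed.

(** The neighborhood [U p] witnesses isolation in any set that omits the points
    of smaller rank. *)
Lemma weak_isolated a (p : T) (A : set T) :
  P a p -> A p -> below P a `&` A = set0 -> isolated A p.
Proof.
move=> Pa Ap PA0; split; first exact/mem_set.
have UP := weak_ranked; exists (U p).
  apply: open_nbhs_nbhs; split; first exact: (weak_clopen p).1.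
  exact: (ranked_self UP).
apply/seteqP; split=> x; last by move=> ->; split=> //; exact: (ranked_self UP).
move=> [Upx Ax]; apply: contrapT => xp.
have [b ba Pb] := ranked_lt UP Pa Upx xp.
suff : set0 x by []; by rewrite -PA0; split=> //; exists b.
Qed.

Lemma weak_upto a : upto P a `<=` upto (@CB_level T L) a.
Proof.
suff H b (p : T) : P b p -> upto (@CB_level T L) b p.
  move=> p [b /= ba /H[c /= cb cp]]; exists c => //=; exact: le_trans cb ba.
elim/well_ordered_ind: b p => b IH p Pb.
have [[c /= cb cp]|nbelow] := pselect (below (@CB_level T L) b p).
  by exists c => //=; exact: ltW.
exists b => //=; rewrite CB_levelE; apply: weak_isolated Pb nbelow _.
rewrite -subset0 => x [[c /= cb Pc]]; apply.
by have [d /= dc dx] := IH c cb x Pc; exists d => //=; exact: le_lt_trans dc cb.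
Qed.

Lemma weak_scattered : scattered T.
Proof.
exists L; apply/seteqP; split=> // x _; have [a Pa] := ranked_ex weak_ranked x.
have [|b _ bx] := @weak_upto a x; last by exists b.
by exists a => //=.
Qed.

Lemma weak_LLSP : LLSP_space T.
Proof.
have UP := weak_ranked; split.
- move=> x; exists (U x); last exact: weak_lindelof.
  apply: open_nbhs_nbhs; split; first exact: (weak_clopen x).1.
  exact: (ranked_self UP).
- exact: weak_scattered.
- exact: (@ranked_hausdorff T U L P UP weak_clopen).
- exact: cone_topology_P_space.
Qed.

End WeakAssignment.

(** By induction the points below level [a] are the points of rank below [a].  A
    point [p] of rank greater than [a] is not isolated among the others: clause
    (d) puts a point of rank [a] into each basic neighborhood of [p]. *)
Lemma LLSP_cone_CB_level (L : well_ordered_type) (P : L -> set X) :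
  LLSP_cone_assignment U P -> forall a, @CB_level T L a = P a.
Proof.
move=> [weakU dU]; have UP := weak_ranked weakU.
elim/well_ordered_ind => a IH; rewrite CB_levelE.
have -> : below (@CB_level T L) a = below P a.
  by apply: eq_bigcupr => b /= ba; exact: IH.
have Pbelow q : P a q -> ~ below P a q.
  by move=> Pa [c /= ca Pc]; move: ca; rewrite (ranked_uniq UP Pc Pa) ltxx.
apply/seteqP; split=> p; last first.
  move=> Pa; apply: (weak_isolated weakU Pa (Pbelow p Pa)).
  by rewrite setICr.
move=> [/set_mem nbp [V Vp Vbp]]; have [b Pb] := ranked_ex UP p.
have [ba|ab|ab] := ltgtP b a; last by rewrite -ab.
  by exfalso; apply: nbp; exists b.
have [_ [I Ip <-] IV] := (weak_neighborhood_system weakU p).2 V Vp.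
have [q [Iq Pq]] := dU a b p I ab Pb Ip.
have qp : q = p.
  suff : [set p] q by []; rewrite -Vbp; split; first exact: IV.
  exact: Pbelow.
by move: ab; rewrite qp in Pq; rewrite (ranked_uniq UP Pq Pb) ltxx.
Qed.

End ConeTopology.

(** * Cantor-Bendixson levels *)

Section CantorBendixson.
Variable T : topologicalType.

Lemma CB_level_notbelow (L : well_ordered_type) (a : L) (x : T) :
  CB_level a x -> ~ below (@CB_level T L) a x.
Proof. by rewrite CB_levelE => /isolatedS. Qed.

(** Scatteredness may be witnessed by a well-order unrelated to [L].  If the levels
    indexed by [L] missed some points, a missed point whose level along the other
    well-order is least would be isolated among the missed points, contradicting
    [CB_height]. *)
Lemma CB_height_cover (L : well_ordered_type) :
  scattered T -> CB_height T L -> \bigcup_a @CB_level T L a = setT.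
Proof.
move=> [M MT] [L0 _]; apply: contrapT => nT.
set A := ~` \bigcup_a @CB_level T L a in L0.
have [x Ax] : A !=set0.
  by apply/set0P/eqP => A0; apply: nT; rewrite -[LHS]setCK -/A A0 setC0.
have [a _ ax] : (\bigcup_a @CB_level T M a) x by rewrite MT.
have [b [y [Ay by_]] bmin] :=
  @well_ordered_min M [set a | exists y, A y /\ CB_level a y] a
    (ex_intro _ x (conj Ax ax)).
have : isolated A y; last by rewrite L0.
move: by_; rewrite CB_levelE => -[_ [V Vy Vb]].
split; first exact/mem_set.
exists V => //; apply/seteqP; split=> z; last first.
  by move=> ->; split=> //; exact: nbhs_singleton.
move=> [Vz Az]; rewrite -Vb; split=> // -[c /= cb cz].
by have := bmin c (ex_intro _ z (conj Az cz)); rewrite leNgt cb.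
Qed.

Lemma CB_level_partition (L : well_ordered_type) :
  scattered T -> CB_height T L -> partition setT (@CB_level T L) setT.
Proof.
move=> scT hL; split.
- exact: CB_height_cover.
- move=> a b _ _ [x [ax bx]].
  have [ab|ba|//] := ltgtP a b; exfalso.
    by apply: (CB_level_notbelow bx); exists a.
  by apply: (CB_level_notbelow ax); exists b.
- by move=> a _; apply/set0P/eqP; exact: hL.2.
Qed.

(** Take the least level [c >= a] that [V] meets.  A point [q] of [V] at level [c]
    is isolated among the points of [V] not below level [a], as all of these
    are not below level [c] either; hence [q] itself has level [a]. *)
Lemma CB_level_meets (L : well_ordered_type) (a b : L) (V : set T) p :
  (a <= b)%O -> CB_level b p -> open V -> V p -> V `&` CB_level a !=set0.
Proof.
move=> ab bp Vo Vp.
have [c [ac [q [Vq cq]]] cmin] := @well_ordered_min L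
  [set c | (a <= c)%O /\ exists q, V q /\ CB_level c q] b
  (conj ab (ex_intro _ p (conj Vp bp))).
exists q; split=> //; rewrite CB_levelE.
have nqa : ~ below (@CB_level T L) a q.
  move=> [d /= da dq]; apply: (CB_level_notbelow cq).
  by exists d => //=; exact: lt_le_trans da ac.
split; first exact/mem_set.
move: (cq); rewrite CB_levelE => -[_ [W Wq Wc]].
exists (V `&` W); first by apply: filterI => //; exact: open_nbhs_nbhs.
apply/seteqP; split=> x; last first.
  by move=> ->; split=> //; split=> //; exact: nbhs_singleton.
move=> [[Vx Wx] nxa]; rewrite -Wc; split=> // -[d /= dc dx].
have [ad|da] := leP a d; last by apply: nxa; exists d.
by have := cmin d (conj ad (ex_intro _ x (conj Vx dx))); rewrite leNgt dc.
Qed.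

End CantorBendixson.

Theorem theorem2p6 (X : Type) :
  (forall (U : X -> set X) (delta : well_ordered_type) (P : delta -> set X),
     weak_LLSP_cone_assignment U P ->
     exists tauU : topology_on X,
       [/\ cone_topology U tauU /\ LLSP_space (space tauU),
           (forall p : X, @clopen (space tauU) (U p) /\
                          @lindelof (space tauU) (U p)),
           (forall a : delta,
              upto P a `<=` upto (@CB_level (space tauU) delta) a)
         & (LLSP_cone_assignment U P ->
            forall a : delta, @CB_level (space tauU) delta a = P a)])
  /\
  (forall (tau : topology_on X) (delta : well_ordered_type) (U : X -> set X),
     LLSP_space (space tau) ->
     CB_height (space tau) delta ->
     (forall p : X, opens tau (U p) /\ U p p) ->
     (forall (a : delta) (p : X), @CB_level (space tau) delta a p ->
        [/\ @clopen (space tau) (U p), @lindelof (space tau) (U p)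
          & U p `\` below (@CB_level (space tau) delta) a = [set p]]) ->
     LLSP_cone_assignment U (@CB_level (space tau) delta) /\
     cone_topology U tau).
Proof.
split.
  move=> U delta P weakU; exists (cone_topology_on U); split.
  - split; last exact: weak_LLSP weakU.
    exact/cone_topologyP/(weak_neighborhood_system weakU).
  - by move=> p; split; [exact: (weak_clopen weakU)|exact: (weak_lindelof weakU)].
  - exact: weak_upto weakU.
  - exact: LLSP_cone_CB_level.
move=> tau delta U [_ scT _ PT] hdelta _ UCB.
have partP := CB_level_partition scT hdelta.
have UP : ranked_assignment U (@CB_level (space tau) delta).
  split=> // b p bp; have [_ _ Up] := UCB b p bp; split.
    by have [] : (U p `\` below (@CB_level (space tau) delta) b) p by rewrite Up.
  move=> x [Upx xp]; apply: contrapT => nbx; apply: xp.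
  by suff : [set p] x by []; rewrite -Up.
have Uclopen p : @clopen (space tau) (U p).
  by have [a ap] := ranked_ex UP p; have [] := UCB a p ap.
have Ulindelof p : @lindelof (space tau) (U p).
  by have [a ap] := ranked_ex UP p; have [] := UCB a p ap.
split; last first.
  apply: cone_topologyP.
  exact: (@lindelof_cone_base (space tau) U _ _ PT UP Uclopen Ulindelof).
split; first exact: (@lindelof_weak (space tau) U _ _ UP Uclopen Ulindelof).
move=> a b p I ab bp Ip.
have [Io Ipp] := @cone_base_open_nbhs (space tau) U _ _ PT UP Uclopen p
  (U p `\` cones U I) (ex_intro2 _ _ I Ip erefl).
exact: CB_level_meets (ltW ab) bp Io Ipp.
Qed.
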